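(* Let $d\ge1$ and let $\mathbb P_\xi$ be the law of an $\mathbb R^d$-valued random variable $\xi$ with $\mathbb E[|\xi|_2]<\infty$. Assume that $\mathbb P_\xi$ has a density $f_\xi$ and that the characteristic function $t\mapsto\mathbb E[e^{i\langle t,\xi\rangle}]$ has no zero in $\mathbb R^d$. Then $\mathbb P_\xi$ is martingality-preserving: for every probability measure $\mathbb P$ on $\mathbb R^d\times\mathbb R^d$ and $(X,Y,\xi)\sim\mathbb P\otimes\mathbb P_\xi$ with $\mathbb E[|(X,Y)|_2]<\infty$, $$(X,Y)\text{ is a martingale}\iff (X+\xi,Y+\xi)\text{ is a martingale}.$$
   Context: $|\cdot|_2$ is the Euclidean norm. A pair $(U,V)$ of integrable $\mathbb R^d$-valued random variables is called a martingale if $\mathbb E[V|U]=U$ almost surely. $(X,Y,\xi)\sim\mathbb P\otimes\mathbb P_\xi$ means that $(X,Y)\sim\mathbb P$, $\xi\sim\mathbb P_\xi$, and $(X,Y)$ is independent of $\xi$. *)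

(* Defs.v *)
From HB Require Import structures.
From mathcomp Require Import all_boot all_order all_algebra complex.
From mathcomp Require Import all_classical all_reals all_analysis.

Set Implicit Arguments.
Unset Strict Implicit.
Unset Printing Implicit Defensive.

Import Order.TTheory GRing.Theory Num.Theory.
Import numFieldNormedType.Exports.

Local Open Scope classical_set_scope.
Local Open Scope ring_scope.

(* Vectors of R^d are d.-tuple R: the library equips tuples with the product of
   the Borel sigma-algebras, which is the Borel sigma-algebra of R^d. *)
Section vectors.
Context {R : realType} {d : nat}.

Definition vadd (x y : d.-tuple R) : d.-tuple R :=
  [tuple tnth x i + tnth y i | i < d].

Definition vdot (x y : d.-tuple R) : R := \sum_(i < d) tnth x i * tnth y i.

Definition norm2 (x : d.-tuple R) : R := Num.sqrt (\sum_(i < d) tnth x i ^+ 2).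

End vectors.

(* The library has products of two measures only, so Lebesgue measure on R^n is
   built by recursion on n, transporting along R * R^n ~ R^(n+1). *)
Section lebesgue_vectors.
Local Open Scope ereal_scope.
Context {R : realType}.

Definition vcons n (p : R * n.-tuple R) : n.+1.-tuple R :=
  [tuple of p.1 :: p.2].

Lemma measurable_vcons n : measurable_fun [set: R * n.-tuple R] (@vcons n).
Proof. exact: (measurable_cons measurable_fst measurable_snd). Qed.

Section step.
Variables (n : nat) (m : {sigma_finite_measure set (n.-tuple R) -> \bar R}).

Definition lebesgue_step : set (n.+1.-tuple R) -> \bar R :=
  pushforward (@lebesgue_measure R \x m) (@vcons n).

Let lebesgue_step0 : lebesgue_step set0 = 0.
Proof. by rewrite /lebesgue_step /pushforward preimage_set0 measure0. Qed.

Let lebesgue_step_ge0 A : 0 <= lebesgue_step A.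
Proof. exact: (measure_ge0 (@lebesgue_measure R \x m)). Qed.

Let lebesgue_step_sigma_additive : semi_sigma_additive lebesgue_step.
Proof.
have mp A : measurable A -> measurable (@vcons n @^-1` A).
  by move=> mA; rewrite -[X in measurable X]setTI; exact: measurable_vcons.
move=> F mF tF mUF; rewrite /lebesgue_step /pushforward preimage_bigcup.
apply: (@measure_semi_sigma_additive _ _ _ (@lebesgue_measure R \x m)).
- by move=> k; exact: mp.
- apply/trivIsetP => /= i j _ _ ij; rewrite -preimage_setI.
  by move/trivIsetP : tF => /(_ _ _ _ _ ij) ->//; rewrite preimage_set0.
- by rewrite -preimage_bigcup; exact: mp.
Qed.

HB.instance Definition _ := isMeasure.Build _ _ _ lebesgue_step
  lebesgue_step0 lebesgue_step_ge0 lebesgue_step_sigma_additive.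

Let lebesgue_step_sigma_finite : sigma_finite setT lebesgue_step.
Proof.
have /sigma_finiteP[F [TF ndF Foo]] := sigma_finiteT (@lebesgue_measure R).
have /sigma_finiteP[G [TG ndG Goo]] := sigma_finiteT m.
exists (fun k => [set x | F k (thead x) /\ G k [tuple of behead x]]).
  rewrite predeqE => x; split=> // _.
  have [k _ Fk] : (\bigcup_i F i) (thead x) by rewrite -TF.
  have [l _ Gl] : (\bigcup_i G i) [tuple of behead x] by rewrite -TG.
  exists (maxn k l) => //; split.
  - by move: Fk; exact/subsetPset/ndF/leq_maxl.
  - by move: Gl; exact/subsetPset/ndG/leq_maxr.
move=> k; have [mF Fk] := Foo k; have [mG Gk] := Goo k; split.
  apply: measurableI; rewrite -[X in measurable X]setTI.
  - exact: (measurable_tnth ord0).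
  - exact: measurable_behead.
rewrite /lebesgue_step /pushforward (_ : _ @^-1` _ = F k `*` G k).
  by rewrite product_measure1E// lte_mul_pinfty// ge0_fin_numE.
apply/seteqP; split=> -[a t] /=; rewrite theadE (_ : [tuple of _] = t) //;
  exact/val_inj.
Qed.

HB.instance Definition _ := Measure_isSigmaFinite.Build _ _ _ lebesgue_step
  lebesgue_step_sigma_finite.
End step.

Fixpoint lebesgue_vec n : {sigma_finite_measure set (n.-tuple R) -> \bar R} :=
  match n with
  | 0%N => \d_[tuple]
  | n'.+1 => lebesgue_step (lebesgue_vec n')
  end.

Lemma lebesgue_vec_box n (a b : n.-tuple R) :
  (forall i, tnth a i <= tnth b i)%R ->
  lebesgue_vec n [set x | forall i, (tnth a i <= tnth x i <= tnth b i)%R] =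
  (\prod_(i < n) (tnth b i - tnth a i)%R)%:E.
Proof.
elim: n a b => [|n IH] a b ab.
  by rewrite big_ord0 /= diracE mem_set// => -[].
set a' := [tuple of behead a]; set b' := [tuple of behead b].
have tl (x : n.+1.-tuple R) i : tnth x (lift ord0 i) = tnth [tuple of behead x] i.
  by rewrite [in LHS](tuple_eta x) tnthS.
have ab' i : (tnth a' i <= tnth b' i)%R by rewrite -!tl.
rewrite big_ord_recl; under eq_bigr do rewrite !tl.
rewrite EFinM -(IH _ _ ab') /= /lebesgue_step /pushforward.
set B := [set x | forall i, (tnth a' i <= tnth x i <= tnth b' i)%R].
have mB : measurable B.
  rewrite (_ : B = \bigcap_(i in [set: 'I_n])
      ((fun x => tnth x i) @^-1` `[tnth a' i, tnth b' i])); last first.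
    apply/seteqP; split=> x /= Bx i; first by move=> _; rewrite /= in_itv/=; exact: Bx.
    by have := Bx i I; rewrite /= in_itv.
  apply: fin_bigcap_measurable => // i _.
  by rewrite -[X in measurable X]setTI; exact: measurable_tnth.
rewrite (_ : _ @^-1` _ = `[tnth a ord0, tnth b ord0]%classic `*` B).
  rewrite product_measure1E//; congr (_ * _).
  rewrite -[LHS]/(lebesgue_measure _) lebesgue_measure_itv/= lte_fin.
  case: ltP => // ba; apply/esym; rewrite (_ : (_ - _ = 0)%R) //.
  by apply/eqP; rewrite subr_eq0 eq_le ba ab.
have vK (p : R * n.-tuple R) : [tuple of behead (vcons p)] = p.2 by exact/val_inj.
apply/seteqP; split=> -[x t] /=; rewrite in_itv/= => H.
  split=> [|i]; first by have := H ord0; rewrite tnth0.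
  by have := H (lift ord0 i); rewrite !tl vK.
move=> i; have [j ->|->] := unliftP ord0 i; last by rewrite tnth0; case: H.
by have [_ /(_ j)] := H; rewrite !tl vK.
Qed.

End lebesgue_vectors.

Section probability.
Context {R : realType} {dO : measure_display} {O : measurableType dO}.
Variable P : probability O R.

Definition char_fun d (X : O -> d.-tuple R) (t : d.-tuple R) : R[i] :=
  (fine 'E_P[fun w => cos (vdot t (X w))]%E +i*
   fine 'E_P[fun w => sin (vdot t (X w))]%E)%C.

Definition integrable_rvec d (X : O -> d.-tuple R) : Prop :=
  measurable_fun [set: O] X /\ ('E_P[norm2 \o X] < +oo)%E.

(* Z is a version of E[V | U]. *)
Definition is_cond_exp d e (V : O -> d.-tuple R) (U : O -> e.-tuple R)
    (Z : O -> d.-tuple R) : Prop :=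
  [/\ integrable_rvec Z,
      g_sigma_algebra_preimage Z `<=` g_sigma_algebra_preimage U &
      forall A, g_sigma_algebra_preimage U A -> forall i : 'I_d,
        (\int[P]_(w in A) (tnth (Z w) i)%:E =
         \int[P]_(w in A) (tnth (V w) i)%:E)%E].

(* E[V | U] is defined up to P-almost sure equality, so E[V | U] = U a.s. means
   that some (equivalently, every) version of E[V | U] is a.s. equal to U. *)
Definition martingale d (U V : O -> d.-tuple R) : Prop :=
  [/\ integrable_rvec U, integrable_rvec V &
      exists2 Z, is_cond_exp V U Z & {ae P, forall w, Z w = U w}].

Definition has_law d' (T : measurableType d') (X : O -> T)
    (Q : probability T R) : Prop :=
  measurable_fun [set: O] X /\
  forall A, measurable A -> pushforward P X A = Q A.

Definition independent d1 d2 (T1 : measurableType d1) (T2 : measurableType d2)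
    (X : O -> T1) (Y : O -> T2) : Prop :=
  forall A B, measurable A -> measurable B ->
    (P (X @^-1` A `&` Y @^-1` B) = P (X @^-1` A) * P (Y @^-1` B))%E.

End probability.

Definition is_density (R : realType) d (Q : probability (d.-tuple R) R)
    (f : d.-tuple R -> R) : Prop :=
  [/\ measurable_fun setT f, forall x, 0 <= f x &
      forall A, measurable A ->
        (Q A = \int[lebesgue_vec d]_(x in A) (f x)%:E)%E].

(* [tuple of X w ++ Y w] is (X w, Y w) seen as a vector of R^(d + d). *)
Definition martingality_preserving (R : realType) d
    (Q : probability (d.-tuple R) R) : Prop :=
  forall (P : probability (d.-tuple R * d.-tuple R)%type R)
    (dO : measure_display) (O : measurableType dO) (Pr : probability O R)
    (X Y xi : O -> d.-tuple R),
  has_law Pr (fun w => (X w, Y w)) P -> has_law Pr xi Q ->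
  independent Pr (fun w => (X w, Y w)) xi ->
  ('E_Pr[fun w => norm2 [tuple of X w ++ Y w]] < +oo)%E ->
  martingale Pr X Y <->
  martingale Pr (fun w => vadd (X w) (xi w)) (fun w => vadd (Y w) (xi w)).

(* Main.v *)
Require Import Defs.
From mathcomp Require Import all_boot all_order all_algebra complex.
From mathcomp Require Import all_classical all_reals all_analysis.
From mathcomp Require Import measurable_realfun ring lra.

(** A pair (U, V) of integrable random vectors is a martingale if and only if
    each coordinate of W = V - U is orthogonal to every event of the sigma-algebra
    of U: E[W 1_B(U)] = 0 for all Borel sets B ([martingaleP]).  Adding the same
    noise to both components leaves V - U unchanged, so the question is only
    whether orthogonality to the events of X amounts to orthogonality to the
    events of X + xi.

    Both can be tested on the waves cos(<t, U> + s) instead of the events: W is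
    orthogonal to all events of U if and only if E[W cos(<t, U> + s)] = 0 for all
    t and s ([trig_nullP]).  On waves the noise is transparent.  Writing
    a(t, s) = E[W cos(<t, X> + s)], independence and the addition formula give

      E[W cos(<t, X + xi> + s)]
        = a(t, s) E[cos <t, xi>] - a(t, s - pi/2) E[sin <t, xi>].

    If all a(t, s) vanish, so does the left-hand side.  Conversely, if the
    left-hand side vanishes at s and at s - pi/2, then, as a(t, s - pi) = - a(t, s),
    the pair (a(t, s), a(t, s - pi/2)) solves a homogeneous linear system whose
    determinant is the squared modulus of the characteristic function of xi at t;
    this is not zero, hence a(t, s) = 0 ([trig_null_translate]).

    What remains is the uniqueness theorem for Fourier transforms of finite signed
    measures on R^d ([trig_null_indic]).  Call a bounded function m a multiplier
    if multiplication by m preserves the weights that are orthogonal to all waves.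
    Multipliers form an algebra closed under bounded pointwise limits, and waves
    are multipliers, a product of two waves being half the sum of two waves.  Iterating
    the polynomial (3 u - u^3) / 2 on [-1, 1] converges to the sign of u, so the
    sign of a wave is a multiplier; the sign of sin((x_i - a) / n) tends to the
    sign of x_i - a, so the indicators of the half-spaces x_i > a are multipliers.
    The sets whose indicators are multipliers form a sigma-algebra, which therefore
    contains all Borel sets. *)

Set Implicit Arguments.
Unset Strict Implicit.
Unset Printing Implicit Defensive.

Import Order.TTheory GRing.Theory Num.Theory.
Import numFieldNormedType.Exports.

Local Open Scope classical_set_scope.
Local Open Scope ring_scope.

(** * Integrable real functions *)

Section real_integrals.
Context {R : realType} {dO : measure_display} {O : measurableType dO}.
Variable P : probability O R.
Implicit Types (f g m : O -> R).

Notation L1 f := (P.-integrable [set: O] (EFin \o f)).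

Lemma L1_measurable f : L1 f -> measurable_fun setT f.
Proof. by move=> /measurable_int/measurable_EFinP. Qed.

Lemma le_L1 f g : measurable_fun setT f -> (forall w, `|f w| <= `|g w|) ->
  L1 g -> L1 f.
Proof.
move=> mf fg; apply: le_integrable => //; first exact/measurable_EFinP.
by move=> w _ /=; rewrite lee_fin.
Qed.

Lemma L1_cst (c : R) : L1 (fun=> c).
Proof. exact: finite_measure_integrable_cst. Qed.

Lemma L1_bounded f K : measurable_fun setT f -> (forall w, `|f w| <= K) -> L1 f.
Proof.
move=> mf fK; apply: (le_L1 mf _ (L1_cst K)) => w.
by rewrite (le_trans (fK w))// ler_norm.
Qed.

Lemma L1_Mbounded f m K : L1 f -> measurable_fun setT m ->
  (forall w, `|m w| <= K) -> L1 (fun w => f w * m w).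
Proof.
move=> if_ mm mK.
have : L1 (fun w => `|K| * f w).
  by have := integrableZl measurableT `|K| if_; apply: eq_integrable.
apply: le_L1; first by apply: measurable_funM => //; exact: L1_measurable.
by move=> w; rewrite !normrM normr_id mulrC ler_wpM2r// (le_trans (mK w))// ler_norm.
Qed.

Lemma L1D f g : L1 f -> L1 g -> L1 (fun w => f w + g w).
Proof. by move=> i1 i2; have := integrableD measurableT i1 i2; apply: eq_integrable. Qed.

Lemma L1B f g : L1 f -> L1 g -> L1 (fun w => f w - g w).
Proof. by move=> i1 i2; have := integrableB measurableT i1 i2; apply: eq_integrable. Qed.

Lemma L1Z (c : R) f : L1 f -> L1 (fun w => c * f w).
Proof. by move=> i1; have := integrableZl measurableT c i1; apply: eq_integrable. Qed.

(** Dominated convergence, in the form used throughout: vanishing integrals pass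
    to the limit. *)
Lemma dominated_Rintegral0 (f_ : nat -> O -> R) f g :
  (forall n, measurable_fun setT (f_ n)) -> L1 g ->
  (forall n w, `|f_ n w| <= g w) ->
  (forall w, f_ n w @[n --> \oo] --> f w) ->
  (forall n, \int[P]_w f_ n w = 0) -> L1 f /\ \int[P]_w f w = 0.
Proof.
move=> mf_ ig fg cf f0.
have mf : measurable_fun setT f by apply: (measurable_fun_cvg mf_) => w _; exact: cf.
have fing n : L1 (f_ n).
  apply: (le_L1 (mf_ n) _ ig) => w.
  by rewrite (le_trans (fg n w))// ler_norm.
have [] := @dominated_convergence _ O R P _ measurableT
  (fun n => EFin \o f_ n) (EFin \o f) (EFin \o g).
- by move=> n; exact/measurable_EFinP.
- exact/measurable_EFinP.
- by apply: aeW => w _; apply: cvg_EFin; [exact: nearW|exact: cf].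
- exact: ig.
- by apply: aeW => w n _ /=; rewrite lee_fin.
move=> if_ _ cI; split=> //.
rewrite /Rintegral; have -> // : (\int[P]_w (f w)%:E = 0)%E.
apply: (@cvg_unique _ (@ereal_hausdorff R) _ _ _ _ cI).
rewrite (_ : [sequence _]_n = cst 0%E); first exact: cvg_cst.
apply/funext => n /=; rewrite -[LHS]fineK; first by congr EFin; exact: f0.
exact: (integrable_fin_num measurableT (fing n)).
Qed.

End real_integrals.
Notation L1 P f := (integrable P [set: _] (EFin \o f)).

(** * Vectors *)

Section vectors.
Context {R : realType} {d : nat}.
Implicit Types x y : d.-tuple R.

Definition vscale (c : R) (x : d.-tuple R) : d.-tuple R :=
  [tuple c * tnth x i | i < d].

Lemma vdotDl (x y z : d.-tuple R) : vdot (vadd x y) z = vdot x z + vdot y z.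
Proof.
by rewrite /vdot -big_split; apply: eq_bigr => i _; rewrite tnth_mktuple mulrDl.
Qed.

Lemma vdotDr (x y z : d.-tuple R) : vdot x (vadd y z) = vdot x y + vdot x z.
Proof.
by rewrite /vdot -big_split; apply: eq_bigr => i _; rewrite tnth_mktuple mulrDr.
Qed.

Lemma vdotZl c (x y : d.-tuple R) : vdot (vscale c x) y = c * vdot x y.
Proof.
by rewrite /vdot mulr_sumr; apply: eq_bigr => i _; rewrite tnth_mktuple mulrA.
Qed.

Definition vunit (i : 'I_d) : d.-tuple R := [tuple (j == i)%:R | j < d].

Lemma vdot_unit i x : vdot (vunit i) x = tnth x i.
Proof.
rewrite /vdot (bigD1 i)//= tnth_mktuple eqxx mul1r big1 ?addr0// => j ji.
by rewrite tnth_mktuple (negbTE ji) mul0r.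
Qed.

Lemma tnth_vadd x y i : tnth (vadd x y) i = tnth x i + tnth y i.
Proof. exact: tnth_mktuple. Qed.

Lemma norm2_ge0 x : 0 <= norm2 x.
Proof. exact: sqrtr_ge0. Qed.

Lemma ler_tnth_norm2 x i : `|tnth x i| <= norm2 x.
Proof.
rewrite -sqrtr_sqr /norm2 ler_sqrt; last by apply: sumr_ge0 => j _; exact: sqr_ge0.
by rewrite (bigD1 i)//= lerDl; apply: sumr_ge0 => j _; exact: sqr_ge0.
Qed.

Lemma norm2_le_sum x : norm2 x <= \sum_(i < d) `|tnth x i|.
Proof.
have S0 : 0 <= \sum_(i < d) `|tnth x i| by exact: sumr_ge0.
rewrite -[leRHS]ger0_norm// -sqrtr_sqr /norm2 ler_sqrt ?sqr_ge0//.
rewrite expr2 mulr_suml; apply: ler_sum => i _.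
rewrite -real_normK ?num_real// expr2 ler_wpM2l//.
by rewrite (bigD1 i)//= lerDl; exact: sumr_ge0.
Qed.

Lemma measurable_norm2 : measurable_fun setT (@norm2 R d).
Proof.
apply: measurableT_comp.
  by apply: continuous_measurable_fun; exact: sqrt_continuous.
apply: (@measurable_sum _ _ _ _ _ _ (fun i x => tnth x i ^+ 2)) => i.
by apply: measurable_funX; exact: measurable_tnth.
Qed.

Lemma measurable_vdot (t : d.-tuple R) : measurable_fun setT (vdot t).
Proof.
apply: (@measurable_sum _ _ _ _ _ _ (fun i x => tnth t i * tnth x i)) => i.
by apply: measurable_funM => //; exact: measurable_tnth.
Qed.

Lemma measurable_cos_vdot (t : d.-tuple R) : measurable_fun setT (fun y => cos (vdot t y)).
Proof.
apply: measurableT_comp; last exact: measurable_vdot.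
by apply: continuous_measurable_fun; exact: continuous_cos.
Qed.

Lemma measurable_sin_vdot (t : d.-tuple R) : measurable_fun setT (fun y => sin (vdot t y)).
Proof.
apply: measurableT_comp; last exact: measurable_vdot.
by apply: continuous_measurable_fun; exact: continuous_sin.
Qed.

End vectors.

Section norm_of_concatenation.
Context {R : realType} {d e : nat}.
Implicit Types (x : d.-tuple R) (y : e.-tuple R).

Lemma norm2_catl x y : norm2 x <= norm2 [tuple of x ++ y].
Proof.
rewrite /norm2 ler_sqrt; last by apply: sumr_ge0 => i _; exact: sqr_ge0.
rewrite big_split_ord/=; under [X in _ <= X + _]eq_bigr do rewrite tnth_lshift.
by rewrite lerDl; apply: sumr_ge0 => i _; exact: sqr_ge0.
Qed.

Lemma norm2_catr x y : norm2 y <= norm2 [tuple of x ++ y].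
Proof.
rewrite /norm2 ler_sqrt; last by apply: sumr_ge0 => i _; exact: sqr_ge0.
rewrite big_split_ord/=; under [X in _ <= _ + X]eq_bigr do rewrite tnth_rshift.
by rewrite lerDr; apply: sumr_ge0 => i _; exact: sqr_ge0.
Qed.

End norm_of_concatenation.

Section random_vectors.
Context {R : realType} {dO : measure_display} {O : measurableType dO} {d : nat}.
Implicit Types U V : O -> d.-tuple R.

Lemma measurable_coord U i : measurable_fun setT U ->
  measurable_fun setT (fun w => tnth (U w) i).
Proof. exact: measurableT_comp (measurable_tnth i). Qed.

Lemma measurable_vadd U V : measurable_fun setT U -> measurable_fun setT V ->
  measurable_fun setT (fun w => vadd (U w) (V w)).
Proof.
move=> mU mV; apply/measurable_fun_tnthP => i.
rewrite (_ : _ \o _ = fun w => tnth (U w) i + tnth (V w) i).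
  by apply: measurable_funD; exact: measurable_coord.
by apply/funext => w /=; rewrite tnth_vadd.
Qed.

End random_vectors.

Lemma measurable_cat_tuple (R : realType) (dO : measure_display)
    (O : measurableType dO) d e (U : O -> d.-tuple R) (V : O -> e.-tuple R) : measurable_fun setT U ->
  measurable_fun setT V -> measurable_fun setT (fun w => [tuple of U w ++ V w]).
Proof.
move=> mU mV; apply/measurable_fun_tnthP => i; case: (split_ordP i) => j ->.
- rewrite (_ : _ \o _ = fun w => tnth (U w) j); first exact: measurable_coord.
  by apply/funext => w /=; rewrite tnth_lshift.
- rewrite (_ : _ \o _ = fun w => tnth (V w) j); first exact: measurable_coord.
  by apply/funext => w /=; rewrite tnth_rshift.
Qed.

(** * The sign function as a limit *)

Section sign_by_iteration.
Context {R : realType}.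
Implicit Type u : R.

(** The step fixes -1, 0 and 1; these are its only fixed points, and it moves every
    other point of [-1, 1] towards the endpoint of the same sign. *)
Definition sign_step u : R := (3 * u - u ^+ 3) / 2.

Lemma sign_stepN u : sign_step (- u) = - sign_step u.
Proof. by rewrite /sign_step; field. Qed.

Lemma iter_sign_stepN n u : iter n sign_step (- u) = - iter n sign_step u.
Proof. by elim: n => //= n ->; rewrite sign_stepN. Qed.

(** With v an iterate, 1 - sign_step v = (1 - v) ((1 - v) (2 + v) / 2), and the
    last factor is at most 1 - v / 2, hence at most 1 - u / 2 because the iterates
    increase from u. *)
Lemma iter_sign_step_bounds n u : 0 <= u <= 1 ->
  u <= iter n sign_step u <= 1 /\
  1 - iter n sign_step u <= (1 - u / 2) ^+ n.
Proof.
move=> /andP[u0 u1]; elim: n => [|n [/andP[uv v1] e]]/=.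
  by rewrite lexx u1 expr0; split=> //; lra.
set v := iter n _ _ in uv v1 e *; rewrite /sign_step.
have h1 : 0 <= v * ((1 - v) * (1 + v)) by rewrite !mulr_ge0//; lra.
have h2 : 0 <= (1 - v) ^+ 2 * (2 + v) by rewrite mulr_ge0 ?sqr_ge0//; lra.
split; first by apply/andP; split; lra.
have -> : 1 - (3 * v - v ^+ 3) / 2 = (1 - v) * ((1 - v) * (2 + v) / 2) by field.
rewrite exprSr; apply: ler_pM => //; first by lra.
- by rewrite divr_ge0// mulr_ge0//; lra.
- by nra.
Qed.

Lemma cvg_iter_sign_step u : `|u| <= 1 ->
  iter n sign_step u @[n --> \oo] --> Num.sg u.
Proof.
have pos v : 0 < v -> v <= 1 -> iter n sign_step v @[n --> \oo] --> (1 : R).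
  move=> v0 v1.
  have b n := iter_sign_step_bounds n (u := v).
  apply: (@squeeze_cvgr _ _ _ _ (fun n => 1 - (1 - v / 2) ^+ n) (cst 1)).
  - apply: nearW => n; have [|/andP[_ h1] h2] := b n; first by rewrite ltW.
    by rewrite h1 andbT; lra.
  - rewrite -[X in _ --> X]subr0; apply: cvgB; first exact: cvg_cst.
    apply: cvg_expr; rewrite ltr_norml; apply/andP; split; lra.
  - exact: cvg_cst.
rewrite ler_norml => /andP[um u1]; case: (ltrgt0P u) => [u0|u0|->].
- by rewrite gtr0_sg//; exact: pos.
- have -> : (fun n => iter n sign_step u) = fun n => - iter n sign_step (- u).
    by apply/funext => n; rewrite iter_sign_stepN opprK.
  rewrite ltr0_sg//; apply: cvgN; apply: pos; lra.
- rewrite sgr0; apply: cvg_near_cst; apply: nearW.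
  by elim=> //= n ->; rewrite /sign_step; field.
Qed.

(** The sequence is eventually constant: as soon as |x| / (n + 1) < 2, the sine has
    the sign of its argument. *)
Lemma cvg_sg_sin (x : R) : Num.sg (sin (n.+1%:R^-1 * x)) @[n --> \oo] --> Num.sg x.
Proof.
have pos (v : R) : 0 < v -> \forall n \near \oo, Num.sg (sin (n.+1%:R^-1 * v)) = 1.
  move=> v0.
  have e0 : 0 < 2 / v by rewrite divr_gt0.
  near=> n; have nv : n.+1%:R^-1 < 2 / v.
    by near: n; exact: (near_infty_natSinv_lt (PosNum e0)).
  by apply/gtr0_sg/sin2_gt0; rewrite mulr_gt0 ?invr_gt0//= -ltr_pdivlMr.
apply: cvg_near_cst; case: (ltrgt0P x) => [x0|x0|->].
- by rewrite (gtr0_sg x0); exact: pos.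
- rewrite (ltr0_sg x0); have nx0 : 0 < - x by rewrite oppr_gt0.
  near=> n; have : Num.sg (sin (n.+1%:R^-1 * - x)) = 1 by near: n; exact: pos.
  by rewrite mulrN sinN sgrN => /eqP; rewrite eqr_oppLR => /eqP.
- by apply: nearW => n; rewrite mulr0 sin0.
Unshelve. all: by end_near. Qed.

End sign_by_iteration.

(** * Uniqueness of the Fourier transform *)

Section trigonometric_multipliers.
Context {R : realType} {dO : measure_display} {O : measurableType dO}.
Variable P : probability O R.
Context {d : nat}.
Variables (V : O -> d.-tuple R) (mV : measurable_fun [set: O] V).
Implicit Types (W m : O -> R).

(** Thanks to the phase s, cosines alone carry both the real and the imaginary part of
    the Fourier transform. *)
Definition wave t s w : R := cos (vdot t (V w) + s).

Lemma measurable_wave t s : measurable_fun setT (wave t s).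
Proof.
apply: measurableT_comp.
  by apply: continuous_measurable_fun; exact: continuous_cos.
apply: measurable_funD => //; apply: measurableT_comp mV; exact: measurable_vdot.
Qed.

Definition trig_null W : Prop :=
  L1 P W /\ forall t s, \int[P]_w (W w * wave t s w) = 0.

(** Quantifying over all the null weights W, rather than fixing one, is what makes
    multipliers stable under products. *)
Definition multiplier m : Prop :=
  [/\ measurable_fun setT m, exists K, forall w, `|m w| <= K &
      forall W, trig_null W -> trig_null (fun w => W w * m w)].

Lemma L1_wave W t s : L1 P W -> L1 P (fun w => W w * wave t s w).
Proof.
by move=> iW; apply: (L1_Mbounded iW (measurable_wave t s)) => w; exact: cos_max.
Qed.

Lemma trig_nullD W W' : trig_null W -> trig_null W' ->
  trig_null (fun w => W w + W' w).
Proof.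
move=> [iW W0] [iW' W'0]; split; first exact: L1D.
move=> t s; under eq_Rintegral do rewrite mulrDl.
by rewrite RintegralD//; [rewrite W0 W'0 addr0|exact: L1_wave..].
Qed.

Lemma trig_nullZ c W : trig_null W -> trig_null (fun w => c * W w).
Proof.
move=> [iW W0]; split; first exact: L1Z.
move=> t s; under eq_Rintegral do rewrite -mulrA.
by rewrite RintegralZl//; [rewrite W0 mulr0|exact: L1_wave].
Qed.

Lemma multiplier_cst c : multiplier (fun=> c).
Proof.
split=> //; first by exists `|c|.
by move=> W /(trig_nullZ c); under eq_fun do rewrite mulrC.
Qed.

Lemma multiplierM m m' : multiplier m -> multiplier m' ->
  multiplier (fun w => m w * m' w).
Proof.
move=> [mm [K mK] M] [mm' [K' mK'] M']; split; first exact: measurable_funM.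
- by exists (K * K') => w; rewrite normrM ler_pM.
- by move=> W /M/M'; under eq_fun do rewrite -mulrA.
Qed.

Lemma multiplierZ c m : multiplier m -> multiplier (fun w => c * m w).
Proof. exact: (multiplierM (multiplier_cst c)). Qed.

Lemma multiplierD m m' : multiplier m -> multiplier m' ->
  multiplier (fun w => m w + m' w).
Proof.
move=> [mm [K mK] M] [mm' [K' mK'] M']; split; first exact: measurable_funD.
- by exists (K + K') => w; rewrite (le_trans (ler_normD _ _))// lerD.
- move=> W W0; under eq_fun do rewrite mulrDr.
  by apply: trig_nullD; [exact: M|exact: M'].
Qed.

(** The dominating function is K |W|: this is why multipliers are bounded and the
    bound K is common to the whole sequence. *)
Lemma multiplier_lim (m_ : nat -> O -> R) m K :
  (forall n, multiplier (m_ n)) -> (forall n w, `|m_ n w| <= K) ->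
  (forall w, m_ n w @[n --> \oo] --> m w) -> multiplier m.
Proof.
move=> M_ mK cm.
have mm : measurable_fun setT m.
  by apply: (@measurable_fun_cvg _ _ _ _ m_) => [n|w _]; [case: (M_ n)|exact: cm].
have mb w : `|m w| <= K.
  have cn : `|m_ n w| @[n --> \oo] --> `|m w| by apply: cvg_norm; exact: cm.
  rewrite -(cvg_lim (@Rhausdorff R) cn).
  by apply: limr_le; [apply/cvg_ex; eexists; exact: cn|exact: nearW].
split=> //; first by exists K.
move=> W W0; have [iW _] := W0.
have iWm := L1_Mbounded iW mm mb.
split=> // t s.
have iWt := L1_wave t s iW.
have iK : L1 P (fun w => K * `|W w|) by apply: L1Z; exact: integrable_norm.
suff [] : L1 P (fun w => W w * m w * wave t s w) /\
  \int[P]_w (W w * m w * wave t s w) = 0 by [].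
apply: (@dominated_Rintegral0 _ _ _ P (fun n w => W w * m_ n w * wave t s w)
  _ _ _ iK).
- move=> n; apply: measurable_funM; last exact: measurable_wave.
  by apply: measurable_funM; [exact: L1_measurable iW|case: (M_ n)].
- move=> n w; rewrite !normrM mulrC -[leRHS]mul1r; apply: ler_pM => //.
    exact: cos_max.
  by rewrite mulrC ler_wpM2r.
- by move=> w; apply: cvgM (cvg_cst _); apply: cvgM (cm w); exact: cvg_cst.
- by move=> n; have [_ _ /(_ _ W0)[_]] := M_ n; exact.
Qed.

(** The product of two waves is half the sum of the waves at the sum and at the
    difference of their phases. *)
Lemma multiplier_wave t s : multiplier (wave t s).
Proof.
split; first exact: measurable_wave.
  by exists 1 => w; exact: cos_max.
move=> W W0; have [iW V0] := W0; split; first exact: L1_wave.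
move=> t' s'.
have e w : W w * wave t s w * wave t' s' w =
    2^-1 * (W w * wave (vadd t t') (s + s') w) +
    2^-1 * (W w * wave (vadd t (vscale (-1) t')) (s - s') w).
  rewrite /wave !vdotDl vdotZl.
  set a := vdot t (V w); set b := vdot t' (V w).
  have -> : a + b + (s + s') = (a + s) + (b + s') by ring.
  have -> : a + -1 * b + (s - s') = (a + s) - (b + s') by ring.
  by rewrite (cosD (a + s)) (cosB (a + s)); field.
under eq_Rintegral do rewrite e.
by rewrite RintegralD ?RintegralZl ?V0 ?mulr0 ?addr0//; do ?apply: L1Z; exact: L1_wave.
Qed.

Lemma multiplier_sg_wave t s : multiplier (fun w => Num.sg (wave t s w)).
Proof.
have b n w : `|iter n sign_step (wave t s w)| <= 1.
  have c : `|wave t s w| <= 1 by exact: cos_max.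
  have pos (v : R) : 0 <= v <= 1 -> `|iter n sign_step v| <= 1.
    move=> v01; have [/andP[h1 h2] _] := iter_sign_step_bounds n v01.
    by rewrite ger0_norm//; move: v01 => /andP[v0 _]; exact: le_trans h1.
  have [w0|w0] := leP 0 (wave t s w).
    by apply: pos; rewrite w0; move: c; rewrite ger0_norm.
  rewrite -[wave t s w]opprK iter_sign_stepN normrN; apply: pos.
  by move: c; rewrite ltr0_norm// => ->; rewrite andbT oppr_ge0 ltW.
apply: (@multiplier_lim (fun n w => iter n sign_step (wave t s w)) _ 1) => //.
  elim=> [|n IH]; first exact: multiplier_wave.
  rewrite (_ : (fun _ => _) = fun w => 3 / 2 * iter n sign_step (wave t s w) +
    -1 / 2 * (iter n sign_step (wave t s w) * (iter n sign_step (wave t s w) *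
     iter n sign_step (wave t s w)))).
    by apply: multiplierD; apply: multiplierZ => //; do 2 apply: multiplierM => //.
  by apply/funext => w /=; rewrite [in LHS]/sign_step; field.
by move=> w; apply: cvg_iter_sign_step; exact: cos_max.
Qed.

Definition trig_measurable (B : set (d.-tuple R)) : Prop :=
  multiplier (fun w => \1_B (V w)).

(** The sine of (x_i - a) / (n + 1) is a wave of frequency the i-th unit vector
    divided by n + 1, and the indicator of r > 0 is (sg r ^ 2 + sg r) / 2. *)
Lemma trig_measurable_halfspace i (a : R) :
  trig_measurable [set x | a < tnth x i].
Proof.
have Ms : multiplier (fun w => Num.sg (tnth (V w) i - a)).
  apply: (@multiplier_lim (fun n w =>
      Num.sg (sin (n.+1%:R^-1 * (tnth (V w) i - a)))) _ 1).
  - move=> n; rewrite (_ : (fun _ => _) = fun w => Num.sg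
      (wave (vscale n.+1%:R^-1 (vunit i)) (- (n.+1%:R^-1 * a) - pi / 2) w)).
      exact: multiplier_sg_wave.
    apply/funext => w; rewrite /wave vdotZl vdot_unit addrA -mulrBr.
    by rewrite cosB cos_pihalf sin_pihalf mulr0 add0r mulr1.
  - by move=> n w; rewrite normr_sg lern1 leq_b1.
  - by move=> w; exact: cvg_sg_sin.
rewrite /trig_measurable (_ : (fun _ => _) = fun w => 2^-1 *
  (Num.sg (tnth (V w) i - a) * Num.sg (tnth (V w) i - a)
   + Num.sg (tnth (V w) i - a))).
  apply: multiplierZ.
  by apply: multiplierD => //; exact: multiplierM.
apply/funext => w; rewrite indicE.
have [xa|xa|xa] := ltgtP (tnth (V w) i) a.
- by rewrite memNset/= ?(ltr0_sg (x := _ - _)) ?subr_lt0//; [field|rewrite le_gtF// ltW].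
- by rewrite mem_set//= gtr0_sg ?subr_gt0//; field.
- by rewrite memNset/= ?xa ?subrr ?sgr0 ?mulr0 ?addr0 ?mulr0// ltxx.
Qed.

(** Complements are affine in the indicator.  The indicator of the complement of a
    countable union is the limit of the finite products of the indicators of the
    complements. *)
Lemma sigma_algebra_trig_measurable : sigma_algebra setT trig_measurable.
Proof.
split.
- rewrite /trig_measurable; under eq_fun do rewrite indic0.
  exact: multiplier_cst.
- move=> B MB; rewrite setTD /trig_measurable.
  rewrite (_ : (fun _ => _) = fun w => 1 + -1 * \1_B (V w)).
    apply: multiplierD; first exact: multiplier_cst.
    exact: multiplierZ.
  by apply/funext => w; rewrite !indicE in_setC; case: (_ \in _); rewrite /=; ring.
- move=> F MF.
  have MC n : multiplier (fun w => \prod_(i < n) (1 + -1 * \1_(F i) (V w))).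
    elim: n => [|n IH].
      by under eq_fun do rewrite big_ord0; exact: multiplier_cst.
    under eq_fun do rewrite big_ord_recr/=.
    apply: multiplierM => //; apply: multiplierD; first exact: multiplier_cst.
    by apply: multiplierZ; exact: MF.
  have fac01 (B : set (d.-tuple R)) x : `|1 + -1 * \1_B x| <= 1 :> R.
    by rewrite indicE; case: (_ \in _); rewrite ?mulr1 ?mulr0 ?addr0 ?subrr ?normr0 ?normr1.
  have MU : multiplier (fun w => 1 + -1 * \1_(\bigcup_i F i) (V w)).
    apply: (multiplier_lim (K := 1) MC).
      by move=> n w; rewrite normr_prod; apply: prodr_ile1 => i _; rewrite normr_ge0/=.
    move=> w; apply: cvg_near_cst; rewrite indicE.
    have [[k _ Fk]|nF] := pselect ((\bigcup_i F i) (V w)).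
      rewrite mem_set; last by exists k.
      exists k.+1 => // n /= kn.
      rewrite (bigD1 (Ordinal kn))//= indicE mem_set//.
      by rewrite mulr1 subrr mul0r.
    rewrite memNset// mulr0 addr0; apply: nearW => n.
    rewrite big1// => i _; rewrite indicE memNset ?mulr0 ?addr0// => Fi.
    by apply: nF; exists i.
  rewrite /trig_measurable.
  rewrite (_ : (fun _ => _) = fun w => 1 + -1 * (1 + -1 * \1_(\bigcup_i F i) (V w))).
    apply: multiplierD; first exact: multiplier_cst.
    exact: multiplierZ.
  by apply/funext => w; ring.
Qed.

Lemma measurable_trig_measurable (B : set (d.-tuple R)) :
  measurable B -> trig_measurable B.
Proof.
apply: smallest_sub; first exact: sigma_algebra_trig_measurable.
move=> A; rewrite -bigcup_seq => -[i _ [C mC <-]]; rewrite setTI.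
pose S := [set D : set R | trig_measurable ((fun x => tnth x i) @^-1` D)].
suff sub : <<s @RGenOInfty.G R >> `<=` S.
  have mE : @measurable _ R = <<s @RGenOInfty.G R >> := RGenOInfty.measurableE R.
  by apply: sub; rewrite -mE.
apply: smallest_sub; last first.
  by move=> _ [a ->]; have := trig_measurable_halfspace i a;
    congr trig_measurable; apply/seteqP; split=> x /=; rewrite in_itv/= andbT.
have [T0 TC TU] := sigma_algebra_trig_measurable.
split; rewrite /S /=.
- by rewrite preimage_set0.
- by move=> D /TC; rewrite !setTD preimage_setC.
- by move=> F MF; rewrite preimage_bigcup; exact: TU.
Qed.

(** Uniqueness of the Fourier transform, for the signed measure that has density W
    with respect to P, carried to R^d by V: the wave at t = 0 and s = 0 is 1. *)
Lemma trig_null_indic W B : trig_null W -> measurable B ->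
  \int[P]_w (W w * \1_B (V w)) = 0.
Proof.
move=> W0 /measurable_trig_measurable[_ _ /(_ _ W0)[_ /(_ (vscale 0 [tuple of nseq d 0]) 0)]].
rewrite /wave; under eq_Rintegral do rewrite vdotZl mul0r add0r cos0 mulr1.
exact.
Qed.

End trigonometric_multipliers.

(** * Orthogonality to functions of a random variable *)

Section null_against_functions.
Context {R : realType} {dO : measure_display} {O : measurableType dO}.
Variable P : probability O R.
Context {dT : measure_display} {T : measurableType dT}.
Variables (U : O -> T) (mU : measurable_fun [set: O] U).
Variable W : O -> R.
Hypothesis iW : L1 P W.
Hypothesis W0 : forall B, measurable B -> \int[P]_w (W w * \1_B (U w)) = 0.

Import HBSimple HBNNSimple.

Let L1_indic B : measurable B -> L1 P (fun w => W w * \1_B (U w)).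
Proof.
move=> mB; apply: (@L1_Mbounded _ _ _ _ _ _ 1 iW).
  by apply: measurableT_comp mU; exact: measurable_indic.
by move=> w; rewrite indicE; case: (_ \in _); rewrite ?normr1 ?normr0.
Qed.

Let null_simple (h : {nnsfun T >-> R}) : \int[P]_w (W w * h (U w)) = 0.
Proof.
under eq_Rintegral do rewrite fimfunE fsbig_finite//=.
suff H (s : seq R) : L1 P (fun w => W w * \sum_(y <- s) y * \1_(h @^-1` [set y]) (U w))
  /\ \int[P]_w (W w * \sum_(y <- s) y * \1_(h @^-1` [set y]) (U w)) = 0.
  by have [] := H (finmap.enum_fset (fset_set (range h))).
elim: s => [|y s [iS IH]].
  rewrite (_ : (fun w => _) = fun=> 0); last by apply/funext => w; rewrite big_nil mulr0.
  by rewrite Rintegral_cst// mul0r; split=> //; exact: L1_cst.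
have -> : (fun w => W w * \sum_(y0 <- y :: s) y0 * \1_(h @^-1` [set y0]) (U w)) =
  fun w => y * (W w * \1_(h @^-1` [set y]) (U w)) +
  W w * \sum_(y0 <- s) y0 * \1_(h @^-1` [set y0]) (U w).
  by apply/funext => w; rewrite big_cons; ring.
have my : measurable (h @^-1` [set y]).
  by rewrite -[X in measurable X]setTI; exact: measurable_funP.
have iy := L1Z y (L1_indic my).
split; first exact: L1D.
by rewrite RintegralD// RintegralZl ?W0 ?mulr0 ?IH ?addr0//; exact: L1_indic.
Qed.

Let null_ge0 (g : T -> R) : measurable_fun setT g -> (forall x, 0 <= g x) ->
  L1 P (fun w => W w * g (U w)) -> \int[P]_w (W w * g (U w)) = 0.
Proof.
move=> mg g0 ig.
have mEg : measurable_fun setT (EFin \o g) by exact/measurable_EFinP.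
pose h := nnsfun_approx measurableT mEg.
have ch x : h n x @[n --> \oo] --> g x.
  have : (EFin \o h ^~ x) @ \oo --> (g x)%:E.
    by apply: cvg_nnsfun_approx => // y _ /=; rewrite lee_fin.
  exact: fine_cvg.
have hg n x : h n x <= g x.
  rewrite -(cvg_lim (@Rhausdorff R) (ch x)).
  apply: (@nondecreasing_cvgn_le _ (h ^~ x)); last by apply/cvg_ex; exists (g x); exact: ch.
  by move=> a b ab; exact/lefP/nd_nnsfun_approx.
apply: (proj2 (@dominated_Rintegral0 _ _ _ P (fun n w => W w * h n (U w)) _
  (fun w => `|W w * g (U w)|) _ _ _ _ _)).
- move=> n; apply: measurable_funM; first exact: L1_measurable iW.
  by apply: measurableT_comp mU; exact: measurable_funP.
- exact: integrable_norm.
- move=> n w; rewrite !normrM ler_wpM2l// !ger0_norm//.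
- by move=> w; apply: cvgM (ch _); exact: cvg_cst.
- by move=> n; exact: null_simple.
Qed.

(** Orthogonality to the indicators of the events of U extends to all functions g of
    U for which the integral makes sense: by linearity to simple functions, by
    dominated convergence, with bound |W g(U)|, to g >= 0, and then to g by splitting
    it into positive and negative parts. *)
Lemma Rintegral_null_comp (g : T -> R) : measurable_fun setT g ->
  L1 P (fun w => W w * g (U w)) -> \int[P]_w (W w * g (U w)) = 0.
Proof.
move=> mg ig.
have mW := L1_measurable iW.
have sub (k : T -> R) : measurable_fun setT k -> (forall x, 0 <= k x <= `|g x|) ->
  L1 P (fun w => W w * k (U w)) /\ \int[P]_w (W w * k (U w)) = 0.
  move=> mk k01.
  have ik : L1 P (fun w => W w * k (U w)).
    apply: le_L1 ig; first by apply: measurable_funM => //; exact: measurableT_comp mU.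
    move=> w; have /andP[k0 kg] := k01 (U w).
    by rewrite !normrM ler_wpM2l// ger0_norm.
  by split=> //; apply: null_ge0 => // x; case/andP: (k01 x).
have [|x|ip p0] := sub (g^\+)%R; first exact: measurable_funrpos.
  by rewrite funrpos_ge0 /funrpos ge_max normr_ge0 ler_norm.
have [|x|in_ n0] := sub (g^\-)%R; first exact: measurable_funrneg.
  by rewrite funrneg_ge0 /funrneg ge_max normr_ge0 -normrN ler_norm.
under eq_Rintegral do rewrite -{1}(funrposBneg g) mulrBr.
by rewrite RintegralB// p0 n0 subr0.
Qed.

End null_against_functions.

Section orthogonality_to_waves.
Context {R : realType} {dO : measure_display} {O : measurableType dO}.
Variable P : probability O R.
Context {d : nat}.

Lemma trig_nullP (U : O -> d.-tuple R) (W : O -> R) : measurable_fun setT U -> L1 P W ->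
  trig_null P U W <-> forall B, measurable B -> \int[P]_w (W w * \1_B (U w)) = 0.
Proof.
move=> mU iW; split=> [W0 B mB|W0]; first exact: trig_null_indic.
split=> // t s; apply: (Rintegral_null_comp (g := fun x => cos (vdot t x + s)) mU iW W0).
  exact: (measurable_wave (@measurable_id _ _ setT) t s).
exact: L1_wave.
Qed.

End orthogonality_to_waves.

(** * Independence *)

Section independence.
Context {R : realType} {dO : measure_display} {O : measurableType dO}.
Variable P : probability O R.
Context {d1 d2 : measure_display} {T1 : measurableType d1} {T2 : measurableType d2}.

(** Independence says that 1_A(X) - P(X in A) is orthogonal to the events of Y,
    hence to g(Y).  Read the other way, g(Y) - E[g(Y)] is orthogonal to the events of
    X, hence to f(X). *)
Lemma independent_Rintegral (X : O -> T1) (Y : O -> T2) (f : T1 -> R) (g : T2 -> R) K :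
  measurable_fun setT X -> measurable_fun setT Y -> independent P X Y ->
  measurable_fun setT f -> measurable_fun setT g ->
  L1 P (f \o X) -> (forall y, `|g y| <= K) ->
  \int[P]_w (f (X w) * g (Y w)) = \int[P]_w f (X w) * \int[P]_w g (Y w).
Proof.
move=> mX mY XY mf mg iF gK.
have mpX A : measurable A -> measurable (X @^-1` A).
  by move=> mA; rewrite -[X in measurable X]setTI; exact: mX.
have mpY A : measurable A -> measurable (Y @^-1` A).
  by move=> mA; rewrite -[X in measurable X]setTI; exact: mY.
have mgY : measurable_fun setT (g \o Y) by exact: measurableT_comp.
have iG : L1 P (g \o Y) by exact: (L1_bounded (K := K) P mgY (fun w => gK (Y w))).
have Eind (A : set O) : measurable A -> \int[P]_w \1_A w = fine (P A).
  by move=> mA; rewrite /Rintegral integral_indic// setIT.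
have Lind (A : set O) : measurable A -> L1 P \1_A.
  by move=> mA; exact: integrable_indic.
have cIG A : measurable A ->
    \int[P]_w ((g (Y w) - \int[P]_w g (Y w)) * \1_A (X w)) = 0.
  move=> mA; set p := fine (P (X @^-1` A)).
  have iA : L1 P (fun w => \1_A (X w)) by exact: (Lind _ (mpX _ mA)).
  have iAp := L1B iA (L1_cst P p).
  have iAg : L1 P (fun w => \1_A (X w) * g (Y w)) by exact: (L1_Mbounded iA mgY (fun w => gK (Y w))).
  have : \int[P]_w ((\1_A (X w) - p) * g (Y w)) = 0.
    apply: (Rintegral_null_comp mY iAp) => //; last exact: (L1_Mbounded iAp mgY (fun w => gK (Y w))).
    move=> B mB.
    have iB : L1 P (fun w => \1_B (Y w)) by exact: (Lind _ (mpY _ mB)).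
    have E w : (\1_A (X w) - p) * \1_B (Y w) =
        \1_(X @^-1` A `&` Y @^-1` B) w - p * \1_B (Y w).
      by rewrite mulrBl !indicE in_setI -natrM mulnb.
    under eq_Rintegral do rewrite E.
    have mAB : measurable (X @^-1` A `&` Y @^-1` B).
      by apply: measurableI; [exact: mpX|exact: mpY].
    rewrite RintegralB//; [|exact: Lind|exact: L1Z].
    rewrite RintegralZl// (Eind _ mAB) (Eind _ (mpY _ mB)) XY// fineM//.
    - by rewrite subrr.
    - exact: fin_num_measure (mpX _ mA).
    - exact: fin_num_measure (mpY _ mB).
  under eq_Rintegral do rewrite mulrBl.
  rewrite RintegralB//; last exact: L1Z.
  rewrite RintegralZl// => h.
  under eq_Rintegral do rewrite mulrBl mulrC.
  rewrite RintegralB//; last exact: L1Z.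
  by rewrite RintegralZl// (Eind _ (mpX _ mA)) mulrC.
have iFG : L1 P (fun w => f (X w) * g (Y w)) by exact: (L1_Mbounded iF mgY (fun w => gK (Y w))).
have : \int[P]_w ((g (Y w) - \int[P]_w g (Y w)) * f (X w)) = 0.
  have := L1B iG (L1_cst P (\int[P]_w g (Y w))).
  move=> iGc; apply: (Rintegral_null_comp mX iGc cIG mf).
  under eq_fun do rewrite mulrBl (mulrC (g _)).
  by apply: L1B => //; exact: L1Z.
under eq_Rintegral do rewrite mulrBl (mulrC (g _)).
rewrite RintegralB//; last exact: L1Z.
by rewrite RintegralZl// => /eqP; rewrite subr_eq0 => /eqP ->; rewrite mulrC.
Qed.

End independence.

(** * Transfer to the law *)

Section laws.
Context {R : realType} {dT : measure_display} {T : measurableType dT}.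
Variable Q : probability T R.
Context {dO : measure_display} {O : measurableType dO}.
Variables (P : probability O R) (X : O -> T).
Hypothesis XQ : has_law P X Q.

Lemma integral_law (g : T -> \bar R) : measurable_fun setT g ->
  P.-integrable setT (g \o X) -> (\int[P]_w g (X w) = \int[Q]_x g x)%E.
Proof.
move=> mg ig; have [mX eQ] := XQ.
have := integral_pushforward mX mg ig measurableT.
rewrite preimage_setT => <-; apply: eq_measure_integral => A mA _; exact: eQ.
Qed.

Lemma ge0_integral_law (g : T -> \bar R) : measurable_fun setT g ->
  (forall x, 0 <= g x)%E -> (\int[P]_w g (X w) = \int[Q]_x g x)%E.
Proof.
move=> mg g0; have [mX eQ] := XQ.
have := @ge0_integral_pushforward _ _ _ _ _ _ mX P setT g measurableT.
rewrite preimage_setT => <-//.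
by apply: eq_measure_integral => A mA _; exact: eQ.
Qed.

End laws.

Lemma eq_char_fun (R : realType) d (Q : probability (d.-tuple R) R)
    (d1 d2 : measure_display) (O1 : measurableType d1) (O2 : measurableType d2)
    (P1 : probability O1 R) (P2 : probability O2 R)
    (X1 : O1 -> d.-tuple R) (X2 : O2 -> d.-tuple R) t :
  has_law P1 X1 Q -> has_law P2 X2 Q -> char_fun P1 X1 t = char_fun P2 X2 t.
Proof.
move=> l1 l2; have [mX1 _] := l1; have [mX2 _] := l2.
have E (g : d.-tuple R -> R) : measurable_fun setT g -> (forall y, `|g y| <= 1) ->
    'E_P1[fun w => g (X1 w)]%E = 'E_P2[fun w => g (X2 w)]%E.
  move=> mg g1; rewrite unlock.
  have mEg : measurable_fun setT (EFin \o g) by exact/measurable_EFinP.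
  rewrite (integral_law l1 mEg) ?(integral_law l2 mEg)//.
  - by apply: (L1_bounded _ _ (fun w => g1 (X2 w))); exact: measurableT_comp mg _.
  - by apply: (L1_bounded _ _ (fun w => g1 (X1 w))); exact: measurableT_comp mg _.
rewrite /char_fun (E _ (measurable_cos_vdot t) (fun=> cos_max _)).
by rewrite (E _ (measurable_sin_vdot t) (fun=> sin_max _)).
Qed.

(** * Martingales as orthogonality relations *)

Section martingales.
Context {R : realType} {dO : measure_display} {O : measurableType dO}.
Variable P : probability O R.
Context {d : nat}.
Implicit Types U V : O -> d.-tuple R.

(** The Euclidean norm dominates each |x_i| and is dominated by their sum, so
    integrability can be checked coordinatewise. *)
Lemma integrable_rvecP U : integrable_rvec P U <->
  measurable_fun setT U /\ forall i, L1 P (fun w => tnth (U w) i).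
Proof.
rewrite /integrable_rvec unlock.
have mN : measurable_fun setT U -> measurable_fun setT (fun w => norm2 (U w)).
  by move=> mU; apply: measurableT_comp mU; exact: measurable_norm2.
split=> -[mU iU]; split=> //.
  move=> i.
  have iN : L1 P (fun w => norm2 (U w)).
    apply/integrableP; split; first exact/measurable_EFinP/mN.
    rewrite (eq_integral (fun w => (norm2 (U w))%:E))// => w _ /=.
    by rewrite ger0_norm ?norm2_ge0.
  apply: le_L1 iN; first exact: measurable_coord.
  by move=> w; rewrite (le_trans (ler_tnth_norm2 _ _))// ler_norm.
have iN : L1 P (fun w => norm2 (U w)).
  apply: (@le_L1 _ _ _ _ _ (fun w => \sum_(i < d) `|tnth (U w) i|)).
  - exact: mN.
  - move=> w; rewrite !ger0_norm ?norm2_ge0 ?norm2_le_sum//; exact: sumr_ge0.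
  - elim: (index_enum _) => [|i s IH].
      by under eq_fun do rewrite big_nil; exact: L1_cst.
    rewrite (_ : (fun w => _) = fun w => `|tnth (U w) i| + \sum_(j <- s) `|tnth (U w) j|).
      by apply: L1D => //; exact: (integrable_norm (iU i)).
    by apply/funext => w; rewrite big_cons.
have := integrable_lty measurableT iN.
by [].
Qed.

(** For the converse U itself serves as the version of E[V | U]. *)
Lemma martingaleP U V : integrable_rvec P U -> integrable_rvec P V ->
  martingale P U V <-> forall i B, measurable B ->
    \int[P]_w ((tnth (V w) i - tnth (U w) i) * \1_B (U w)) = 0.
Proof.
move=> rU rV; have [mU iU] := (integrable_rvecP U).1 rU.
have [mV iV] := (integrable_rvecP V).1 rV.
have mpU A : measurable A -> measurable (U @^-1` A).
  by move=> mA; rewrite -[X in measurable X]setTI; exact: mU.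
have mi B : measurable B -> measurable_fun setT (fun w => \1_B (U w) : R).
  by move=> mB; apply: measurableT_comp mU; exact: measurable_indic.
have b1 B w : `|\1_B (U w)| <= 1 :> R.
  by rewrite indicE; case: (_ \in _); rewrite ?normr1 ?normr0.
have eqI B i : measurable B ->
    (\int[P]_(w in U @^-1` B) (tnth (U w) i)%:E =
     \int[P]_(w in U @^-1` B) (tnth (V w) i)%:E)%E <->
    \int[P]_w ((tnth (V w) i - tnth (U w) i) * \1_B (U w)) = 0.
  move=> mB; have mUB := mpU _ mB.
  under eq_Rintegral do rewrite mulrBl.
  have iUB := L1_Mbounded (iU i) (mi B mB) (b1 B).
  have iVB := L1_Mbounded (iV i) (mi B mB) (b1 B).
  rewrite RintegralB//.
  have E (Z : O -> d.-tuple R) : L1 P (fun w => tnth (Z w) i * \1_B (U w)) ->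
      (\int[P]_(w in U @^-1` B) (tnth (Z w) i)%:E =
      (\int[P]_w (tnth (Z w) i * \1_B (U w)))%R%:E)%E.
    move=> iZ; rewrite /Rintegral fineK; last exact: (integrable_fin_num measurableT iZ).
    rewrite [LHS]integral_mkcond epatch_indic; apply: eq_integral => w _ /=.
    by rewrite EFinM.
  rewrite !E//; split=> [[->]|/eqP]; first by rewrite subrr.
  by rewrite subr_eq0 => /eqP ->.
split.
- move=> [_ _ [Z [[mZ _] _ ZV] ZU]] i B mB; apply/eqI => //.
  rewrite -ZV; last by exists B => //; rewrite setTI.
  apply: ae_eq_integral => //.
  + exact: mpU.
  + exact/measurable_EFinP/measurable_funTS/measurable_coord/mU.
  + exact/measurable_EFinP/measurable_funTS/measurable_coord/mZ.
  + by apply: filterS ZU => w ZUw _; rewrite /= ZUw.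
- move=> H; split=> //; exists U; last exact: aeW.
  split=> // _ [B mB <-] i; rewrite setTI; exact/eqI/H.
Qed.

End martingales.

(** * Adding an independent noise *)

Section translation.
Context {R : realType} {dO : measure_display} {O : measurableType dO}.
Variable P : probability O R.
Context {d : nat}.

(** The weight D(Z) and the vector x(Z) are functions of one random element Z because
    it is their joint law that has to be independent of the noise. *)
Lemma trig_null_translate (dE : measure_display) (E : measurableType dE)
    (Z : O -> E) (x : E -> d.-tuple R) (D : E -> R) (xi : O -> d.-tuple R) :
  measurable_fun setT x -> measurable_fun setT D ->
  measurable_fun setT Z -> measurable_fun setT xi ->
  independent P Z xi -> L1 P (D \o Z) ->
  (forall t, char_fun P xi t != 0) ->
  trig_null P (x \o Z) (D \o Z) <->
  trig_null P (fun w => vadd (x (Z w)) (xi w)) (D \o Z).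
Proof.
move=> mx mD mZ mxi Zxi iD phi0.
pose C t := \int[P]_w cos (vdot t (xi w)).
pose S t := \int[P]_w sin (vdot t (xi w)).
pose a t s := \int[P]_w (D (Z w) * cos (vdot t (x (Z w)) + s)).
have mX t s : measurable_fun setT (fun e => cos (vdot t (x e) + s)).
  exact: (measurable_wave mx t s).
have shift (r : R) : cos (r - pi / 2) = sin r.
  by rewrite cosB cos_pihalf sin_pihalf mulr0 add0r mulr1.
have iDX t s : L1 P (fun w => D (Z w) * cos (vdot t (x (Z w)) + s)).
  by apply: (L1_wave (measurableT_comp mx mZ)).
have prodE t s (g : d.-tuple R -> R) : measurable_fun setT g -> (forall y, `|g y| <= 1) ->
    L1 P (fun w => D (Z w) * cos (vdot t (x (Z w)) + s) * g (xi w)) /\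
    \int[P]_w (D (Z w) * cos (vdot t (x (Z w)) + s) * g (xi w)) =
    a t s * \int[P]_w g (xi w).
  move=> mg g1; split.
    by apply: (L1_Mbounded (K := 1) (iDX t s)) => //; exact: measurableT_comp.
  apply: (independent_Rintegral (f := fun e => D e * cos (vdot t (x e) + s))
    mZ mxi Zxi _ mg _ g1); last exact: iDX.
  exact: measurable_funM.
have key t s : \int[P]_w (D (Z w) * cos (vdot t (vadd (x (Z w)) (xi w)) + s)) =
    a t s * C t - a t (s - pi / 2) * S t.
  have [i1 <-] := prodE t s _ (measurable_cos_vdot t) (fun y => cos_max _).
  have [i2 <-] := prodE t (s - pi / 2) _ (measurable_sin_vdot t) (fun y => sin_max _).
  rewrite -RintegralB//; apply: eq_Rintegral => w _.
  rewrite vdotDr; set A := vdot t (x (Z w)); set B := vdot t (xi w).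
  by rewrite addrAC (cosD (A + s) B) addrA shift; ring.
have CS t : C t ^+ 2 + S t ^+ 2 != 0.
  apply/negP; rewrite paddr_eq0 ?sqr_ge0// !sqrf_eq0 => /andP[/eqP C0 /eqP S0].
  have /eqP := phi0 t; apply; rewrite /char_fun unlock.
  by rewrite -[fine _]/(C t) C0 -[fine _]/(S t) S0.
split=> -[_ H]; split=> // t s.
  have Ha s' : a t s' = 0 by exact: H.
  by rewrite [LHS]key !Ha !mul0r subrr.
(* The linear system for (a(t, s), a(t, s - pi / 2)) given by [key] at s and s - pi / 2. *)
have k1 := key t s; have k2 := key t (s - pi / 2).
rewrite [LHS]H in k1; rewrite [LHS]H in k2.
have a2 : a t (s - pi / 2 - pi / 2) = - a t s.
  rewrite /a -[RHS]mulN1r -RintegralZl//; apply: eq_Rintegral => w _.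
  by rewrite !addrA shift sinB cos_pihalf sin_pihalf; ring.
rewrite a2 in k2.
have : a t s * (C t ^+ 2 + S t ^+ 2) = 0.
  transitivity (C t * (a t s * C t - a t (s - pi / 2) * S t)
    + S t * (a t (s - pi / 2) * C t - - a t s * S t)); first by ring.
  by rewrite -k1 -k2 !mulr0 addr0.
by move/eqP; rewrite mulf_eq0 (negbTE (CS t)) orbF => /eqP.
Qed.

End translation.

(** * Martingality preservation *)

Theorem proposition1 (R : realType) (d : nat) (hd : (1 <= d)%N)
    (dO : measure_display) (O : measurableType dO) (P : probability O R)
    (xi : {RV P >-> d.-tuple R})
    (hxi : ('E_P[norm2 \o xi] < +oo)%E)
    (f : d.-tuple R -> R) (hf : is_density (distribution P xi) f)
    (hchar : forall t : d.-tuple R, char_fun P xi t != 0) :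
  martingality_preserving (distribution P xi).
Proof.
move=> _ dO' O' Pr X Y xi' [mXY _] lxi' indep iXY.
have lxi : has_law P xi (distribution P xi) by split.
have mX : measurable_fun setT X := measurableT_comp measurable_fst mXY.
have mY : measurable_fun setT Y := measurableT_comp measurable_snd mXY.
have [mxi' _] := lxi'.
have half Z : measurable_fun setT Z ->
    (forall w, norm2 (Z w) <= norm2 [tuple of X w ++ Y w]) -> integrable_rvec Pr Z.
  move=> mZ le; split=> //; apply: le_lt_trans iXY; rewrite unlock.
  apply: ge0_le_integral => //.
  - by move=> w _; rewrite lee_fin norm2_ge0.
  - by apply/measurable_EFinP; exact: measurableT_comp measurable_norm2 mZ.
  - apply/measurable_EFinP; apply: (measurableT_comp measurable_norm2).
    exact: measurable_cat_tuple.
  - by move=> w _; rewrite lee_fin; exact: le.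
have rX : integrable_rvec Pr X by apply: half => // w; exact: norm2_catl.
have rY : integrable_rvec Pr Y by apply: half => // w; exact: norm2_catr.
have rxi' : integrable_rvec Pr xi'.
  split=> //; apply: le_lt_trans hxi; rewrite unlock.
  have mN : measurable_fun setT (EFin \o @norm2 R d).
    by apply/measurable_EFinP; exact: measurable_norm2.
  have n0 x : (0 <= (EFin \o @norm2 R d) x)%E by rewrite lee_fin; exact: norm2_ge0.
  by rewrite (ge0_integral_law lxi' mN n0) (ge0_integral_law lxi mN n0).
have [_ iX] := (integrable_rvecP Pr X).1 rX.
have [_ iY] := (integrable_rvecP Pr Y).1 rY.
have [_ ixi] := (integrable_rvecP Pr xi').1 rxi'.
have rvadd Z : measurable_fun setT Z -> (forall i, L1 Pr (fun w => tnth (Z w) i)) ->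
    integrable_rvec Pr (fun w => vadd (Z w) (xi' w)).
  move=> mZ iZ; apply/integrable_rvecP; split; first exact: measurable_vadd.
  by move=> i; under eq_fun do rewrite tnth_vadd; exact: L1D.
have hchar' t : char_fun Pr xi' t != 0 by rewrite (eq_char_fun t lxi' lxi).
rewrite (martingaleP rX rY).
rewrite (martingaleP (rvadd _ mX iX) (rvadd _ mY iY)).
pose D i (e : d.-tuple R * d.-tuple R) := tnth e.2 i - tnth e.1 i.
have mD i : measurable_fun setT (D i).
  by apply: measurable_funB; apply: measurable_coord.
have iD i : L1 Pr (D i \o (fun w => (X w, Y w))) by exact: L1B.
have trans i := @trig_null_translate _ _ _ Pr _ _ _ _ fst _ _
  measurable_fst (mD i) mXY mxi' indep (iD i) hchar'.
have mU := measurable_vadd mX mxi'.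
have iff i := iff_trans (iff_sym (trig_nullP mX (iD i)))
  (iff_trans (trans i) (trig_nullP mU (iD i))).
have cancel i w : tnth (vadd (Y w) (xi' w)) i - tnth (vadd (X w) (xi' w)) i =
    D i (X w, Y w).
  by rewrite !tnth_vadd /D/=; ring.
split=> H i B mB.
- by under eq_Rintegral do rewrite cancel; exact: (iff i).1 (H i) B mB.
- apply: (iff i).2 => // C mC; rewrite -(H i C mC).
  by apply: eq_Rintegral => w _; rewrite cancel.
Qed.
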